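(* Let $\Omega$ be a bounded domain in $\mathbb{C}^2$. Then there exist infinitely many smooth solutions $u$ to $\det(\partial\bar\partial u)=1$ on $\Omega$ of the form $$u(z,w)=a(w)|\phi(z)|^2+b(w)\phi^2(z)+\overline{b(w)\phi^2(z)}+c(w)\phi(z)+\overline{c(w)\phi(z)}+d(w),$$ where $$\phi(z)=\frac{1-\sqrt{1-2\alpha z}}{\alpha}\quad\text{on } D_{\frac{1}{2|\alpha|}}$$ (principal branch of the square root) for some nonzero complex constant $\alpha$ with $\Omega\subset D_{\frac{1}{2|\alpha|}}\times\mathbb{C}$, and $a,b,c,d$ are smooth functions of $w$, with $a,d$ real-valued, $a>0$, and $b,c$ complex-valued.
   Context: Coordinates on $\mathbb{C}^2$ are $(z,w)$; $D_r=\{z\in\mathbb{C}:|z|<r\}$. The functions $a,b,c,d$ are defined on the projection of $\Omega$ to the $w$-plane. For a real-valued function $u$ on an open subset of $\mathbb{C}^2$, $\partial\bar\partial u$ denotes its complex Hessian, the $2\times 2$ matrix $\begin{bmatrix} u_{\bar z z} & u_{z\bar w}\\ u_{\bar z w} & u_{\bar w w}\end{bmatrix}$. *)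

(* Defs.v *)
From HB Require Import structures.
From mathcomp Require Import all_boot all_order all_algebra.
From mathcomp Require Import all_classical all_reals all_analysis.
From mathcomp Require Export complex.

Set Implicit Arguments.
Unset Strict Implicit.
Unset Printing Implicit Defensive.

Import Order.TTheory GRing.Theory Num.Theory.
Import numFieldNormedType.Exports.

Local Open Scope classical_set_scope.
Local Open Scope ring_scope.

(* [Rcomplex R] is the field [R[i]] seen as a real vector space, normed by the
   real-valued modulus.  The library stops there; the instances below add the
   topology of the modulus and make it a normed module over [R], so that
   [Rcomplex R * Rcomplex R] is one too and ['D_v] is the derivative along a
   real direction. *)
Section Rcomplex_topology.
Variable R : realType.

HB.instance Definition _ :=
  PseudoMetric.copy (Rcomplex R) (pseudoMetric_normed (Rcomplex R)).

HB.instance Definition _ := isPointed.Build (Rcomplex R) 0.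

HB.instance Definition _ :=
  NormedZmod_PseudoMetric_eq.Build R (Rcomplex R) erefl.

Lemma normRcomplexZ (l : R) (x : Rcomplex R) : `|l *: x| = `|l| * `|x|.
Proof.
case: x => a b; rewrite /Num.norm/= !exprMn -mulrDr sqrtrM ?sqr_ge0//.
by rewrite sqrtr_sqr.
Qed.

HB.instance Definition _ :=
  PseudoMetricNormedZmod_Lmodule_isNormedModule.Build R (Rcomplex R)
    normRcomplexZ.

End Rcomplex_topology.

Definition Complex2 (R : realType) := (Rcomplex R * Rcomplex R)%type.

Definition bounded_domain (R : realType) (A : set (Complex2 R)) : Prop :=
  [/\ A !=set0, open A, connected A & bounded_set A].

(* All iterated directional derivatives of order at most [k] exist on [A], and
   those of order [k] are continuous at the points of [A].  For [A] open and
   [V] finite-dimensional this is the usual class C^k on [A]. *)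
Fixpoint is_Ck (R : realType) (V W : normedModType R) (k : nat) (A : set V)
    (f : V -> W) : Prop :=
  if k is k'.+1 then
    forall v : V, (forall x, A x -> derivable f x v) /\ is_Ck k' A ('D_v f)
  else forall x, A x -> {for x, continuous f}.

Definition smooth_on (R : realType) (V W : normedModType R) (A : set V)
    (f : V -> W) : Prop :=
  forall k, is_Ck k A f.

Definition toC (R : realType) (x : R) : Rcomplex R := x%:C%C.

Definition conjC (R : realType) (z : Rcomplex R) : Rcomplex R := conjc z.

Definition imagC (R : realType) : Rcomplex R := 'i%C.

(* The coordinate vectors: index 0 is [z], index 1 is [w]. *)
Definition coord_vec (R : realType) (i : 'I_2) : Complex2 R :=
  if i == ord0 then (1, 0) else (0, 1).

Definition coord_ivec (R : realType) (i : 'I_2) : Complex2 R :=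
  if i == ord0 then (imagC R, 0) else (0, imagC R).

Definition wirtinger (R : realType) (i : 'I_2)
    (f : Complex2 R -> Rcomplex R) (p : Complex2 R) : Rcomplex R :=
  2^-1 * ('D_(coord_vec R i) f p - imagC R * 'D_(coord_ivec R i) f p).

Definition wirtinger_bar (R : realType) (i : 'I_2)
    (f : Complex2 R -> Rcomplex R) (p : Complex2 R) : Rcomplex R :=
  2^-1 * ('D_(coord_vec R i) f p + imagC R * 'D_(coord_ivec R i) f p).

Definition complex_hessian (R : realType) (u : Complex2 R -> R)
    (p : Complex2 R) : 'M[Rcomplex R]_2 :=
  \matrix_(i < 2, j < 2)
    wirtinger i (wirtinger_bar j (fun q => toC (u q))) p.

Definition disc (R : realType) (r : R) : set (Rcomplex R) :=
  [set z | `|z| < r].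

(* [sqrtc] is the square root with nonnegative real part, and with nonnegative
   imaginary part on the nonpositive reals: the principal branch. *)
Definition phi (R : realType) (alpha z : Rcomplex R) : Rcomplex R :=
  (1 - (sqrtc (1 - 2 * alpha * z) : Rcomplex R)) / alpha.

Definition ansatz (R : realType) (alpha : Rcomplex R)
    (a : Rcomplex R -> R) (b c : Rcomplex R -> Rcomplex R)
    (d : Rcomplex R -> R) (p : Complex2 R) : Rcomplex R :=
  let: (z, w) := p in
  toC (a w) * toC (`|phi alpha z| ^+ 2)
  + b w * phi alpha z ^+ 2 + conjC (b w * phi alpha z ^+ 2)
  + c w * phi alpha z + conjC (c w * phi alpha z)
  + toC (d w).

Definition has_ansatz (R : realType) (Omega : set (Complex2 R))
    (alpha : Rcomplex R) (u : Complex2 R -> R) : Prop :=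
  exists (a : Rcomplex R -> R) (b c : Rcomplex R -> Rcomplex R)
         (d : Rcomplex R -> R),
    let Omega_w := snd @` Omega in
    [/\ smooth_on Omega_w a, smooth_on Omega_w b,
        smooth_on Omega_w c & smooth_on Omega_w d] /\
    (forall w, Omega_w w -> 0 < a w) /\
    (forall p, Omega p -> toC (u p) = ansatz alpha a b c d p).

(* Main.v *)
Require Import Defs.
From HB Require Import structures.
From mathcomp Require Import all_boot all_order all_algebra ring.
From mathcomp Require Import all_classical all_reals all_analysis.

(** The reason for the theorem is that [phi] solves [phi' * s = 1], where
    [s z = sqrt (1 - 2 alpha z)]: differentiating
    [phi = (1 - s) / alpha] and [s ^ 2 = 1 - 2 alpha z] gives [phi' = 1 / s].
    Hence the holomorphic map [Phi (z, w) = (phi z, w * s z)] has Jacobian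
    determinant [phi' * s = 1].  For holomorphic [f] and [g], the complex
    Hessian of [|f| ^ 2 + |g| ^ 2 + k] is the product of the transposed Jacobian
    of [(f, g)] with its conjugate, so its determinant is the squared modulus of
    the Jacobian determinant ([det_complex_hessian_sqr_norm]).  With
    [(f, g) = Phi] this determinant is 1, for every real constant [k], and the
    different constants give infinitely many solutions.

    These solutions have the required form, because [s = 1 - alpha * phi] and so
    [|phi| ^ 2 + |w| ^ 2 * |1 - alpha * phi| ^ 2 + k] is the quadratic
    expression in [phi] with coefficients [a = 1 + |alpha w| ^ 2], [b = 0],
    [c = - alpha |w| ^ 2] and [d = |w| ^ 2 + k] ([solution_ansatz]).

    A small [alpha] puts the bounded set [Omega] inside the cylinder over
    [|z| < 1 / (2 |alpha|)], where [1 - 2 alpha z] has positive real part; there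
    the principal square root is continuous and does not vanish.  Smoothness in
    the sense of iterated directional derivatives follows from closure of the
    smooth functions under the operations that build [phi] and [s].  Each
    closure property is an induction on the order of differentiation over a
    family of functions whose derivatives stay in the family; the families used
    for the inverse and for the square root ([smooth_onV] and [smooth_on_sqrt])
    are chosen so that a derivative is again a single term. *)

Set Implicit Arguments.
Unset Strict Implicit.
Unset Printing Implicit Defensive.

Import Order.TTheory GRing.Theory Num.Theory.
Import numFieldNormedType.Exports.

Local Open Scope classical_set_scope.
Local Open Scope ring_scope.

(** * Limits of complex-valued functions *)

Lemma is_deriveP (R : realType) (V W : normedModType R) (f : V -> W)
    (x v : V) (df : W) :
  is_derive x v f df <->
  h^-1 *: (f (h *: v + x) - f x) @[h --> 0^'] --> df.
Proof.
split=> [[dfx <-]|fdf]; first exact: dfx.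
by split; [apply/cvg_ex; exists df | exact: cvg_lim fdf].
Qed.

Lemma cvg_along (R : realType) (V : normedModType R) (T : topologicalType)
    (f : V -> T) (x v : V) :
  {for x, continuous f} -> f (h *: v + x) @[h --> (0 : R)^'] --> f x.
Proof.
move=> fx.
apply: (@cvg_comp _ _ _ (fun h : R => h *: v + x) f _ (nbhs x)) => //.
have -> : nbhs x = nbhs ((0 : R) *: v + x) by rewrite scale0r add0r.
apply: cvgD; last exact: cvg_cst.
by apply: cvgZr_tmp; exact/cvg_within.
Qed.

Section complex_limits.
Context {R : realType} {T : Type} {F : set_system T} {FF : Filter F}.
Local Notation C := (Rcomplex R).
Implicit Types f g : T -> C.

Lemma normRcomplexM (x y : C) : `|x * y : C| = `|x| * `|y|.
Proof. exact: ComplexField.Normc.normcM. Qed.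

(** The norm of [Rcomplex R] takes its values in [R] and not in the field
    itself, so products and inverses are estimated through the real limit of
    a majorant. *)
Lemma cvgcM f g (a b : C) : f @ F --> a -> g @ F --> b ->
  (fun t => f t * g t) @ F --> a * b.
Proof.
move=> fa gb; apply/subr_cvg0/norm_cvg0P.
have h0 : (fun t => `|f t - a| * `|g t| + `|a| * `|g t - b|) @ F --> (0 : R).
  have -> : (0 : R) = 0 * `|b| + `|a| * 0 by rewrite mul0r mulr0 addr0.
  apply: cvgD; apply: cvgM.
  - by apply/norm_cvg0P/subr_cvg0.
  - exact: cvg_norm.
  - exact: cvg_cst.
  - by apply/norm_cvg0P/subr_cvg0.
apply: (@squeeze_cvgr _ _ _ _ (fun=> 0) _ _ _ _ _ h0); last exact: cvg_cst.
near=> t; rewrite normr_ge0 /= -!normRcomplexM.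
have -> : f t * g t - a * b = (f t - a) * g t + a * (g t - b) by ring.
exact: ler_normD.
Unshelve. all: by end_near. Qed.

Lemma cvgcV f (a : C) : a != 0 -> f @ F --> a ->
  (fun t => (f t)^-1) @ F --> a^-1.
Proof.
move=> a0 fa; apply/subr_cvg0/norm_cvg0P.
have f0 : \forall t \near F, f t != 0.
  have := cvgr_neq0 _ fa a0. exact.
have h0 : (fun t => `|f t - a| * (`|f t|^-1 * `|a|^-1)) @ F --> (0 : R).
  have -> : (0 : R) = 0 * (`|a|^-1 * `|a|^-1) by rewrite mul0r.
  apply: cvgM; first by apply/norm_cvg0P/subr_cvg0.
  apply: cvgM; last exact: cvg_cst.
  by apply: cvgV; [rewrite normr_eq0 | exact: cvg_norm].
apply: (@squeeze_cvgr _ _ _ _ (fun=> 0) _ _ _ _ _ h0); last exact: cvg_cst.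
near=> t; rewrite normr_ge0 /=.
have ft : f t != 0 by near: t.
have nV (x : C) : `|x^-1 : C| = `|x|^-1 by exact: ComplexField.Normc.normcV.
rewrite -!nV -!normRcomplexM distrC.
have -> : a^-1 - (f t)^-1 = (f t - a) * ((f t)^-1 * a^-1).
  by field; rewrite ft a0.
exact: lexx.
Unshelve. all: by end_near. Qed.

End complex_limits.

(** * Rules for directional derivatives *)

Section derivative_rules.
Context {R : realType} {V : normedModType R}.
Local Notation C := (Rcomplex R).
Implicit Types (f g : V -> C) (x v : V).

Lemma is_derive_linear_comp (W1 W2 : normedModType R) (L : W1 -> W2)
    (f : V -> W1) x v df :
  linear L -> continuous L -> is_derive x v f df ->
  is_derive x v (fun y => L (f y)) (L df).
Proof.
move=> Ll Lc /is_deriveP fdf; apply/is_deriveP.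
have LB (k : R) a b : k *: (L a - L b) = L (k *: (a - b)).
  have LZ c d : L (c *: d) = c *: L d.
    have L0 : L 0 = 0.
      have := Ll 1 0 0; rewrite !scale1r addr0 => /esym/eqP.
      by rewrite -subr_eq0 addrK => /eqP.
    by rewrite -[c *: d]addr0 Ll L0 addr0.
  by rewrite LZ addrC -scaleN1r -Ll scaleN1r [- b + a]addrC.
under eq_fun do rewrite LB.
by apply: (cvg_comp _ _ fdf); exact: Lc.
Qed.

Lemma is_derive_linear (W : normedModType R) (L : V -> W) x v :
  linear L -> continuous L -> is_derive x v L (L v).
Proof. by move=> Ll Lc; exact: (@is_derive_linear_comp V W L id). Qed.

Lemma is_derivecM f g x v (df dg : C) : {for x, continuous g} ->
  is_derive x v f df -> is_derive x v g dg ->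
  is_derive x v (fun y => f y * g y) (df * g x + f x * dg).
Proof.
move=> gx /is_deriveP fdf /is_deriveP gdg; apply/is_deriveP.
rewrite [X in X @ _ --> _](_ : _ = fun h : R =>
  (h^-1 *: (f (h *: v + x) - f x)) * g (h *: v + x)
  + f x * (h^-1 *: (g (h *: v + x) - g x))); last first.
  apply/funext => h; rewrite (mulrC (f x) (_ *: _)) -!scalerAl -scalerDr.
  by congr (_ *: _); ring.
apply: cvgD; apply: cvgcM => //; first exact: cvg_along.
exact: cvg_cst.
Qed.

Lemma is_derivecV f x v (df : C) : {for x, continuous f} -> f x != 0 ->
  is_derive x v f df ->
  is_derive x v (fun y => (f y)^-1) (- df * (f x)^-1 * (f x)^-1).
Proof.
move=> fc fx0 /is_deriveP fdf; apply/is_deriveP.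
have fxh := cvg_along v fc.
apply: (@cvg_trans _ ((fun h : R => - (h^-1 *: (f (h *: v + x) - f x))
   * (f (h *: v + x))^-1 * (f x)^-1) @ 0^')).
  apply: near_eq_cvg; near=> h.
  have fh : f (h *: v + x) != 0.
    by near: h; exact: (cvgr_neq0 _ fxh).
  rewrite -scalerN -!scalerAl; congr (_ *: _); field; rewrite fx0; exact: fh.
apply: cvgcM; last exact: cvg_cst.
by apply: cvgcM; [exact: cvgN | exact: cvgcV].
Unshelve. all: by end_near. Qed.

(** Only continuity of the root has to be known in advance: with
    [h = f y - f x], the difference of the squares is [h * (f y + f x)], and
    the second factor tends to [2 * f x]. *)
Lemma is_derive_sqrt f g x v (df : C) :
  (forall y, f y ^+ 2 = g y) -> {for x, continuous f} -> f x != 0 ->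
  is_derive x v g df -> is_derive x v f (df * (2 * f x)^-1).
Proof.
move=> fg fc fx0 /is_deriveP fdf; apply/is_deriveP.
have fxh : f (h *: v + x) + f x @[h --> (0:R)^'] --> 2 * f x.
  have -> : 2 * f x = f x + f x by ring.
  by apply: cvgD; [exact: cvg_along | exact: cvg_cst].
have fx20 : 2 * f x != 0 by rewrite mulf_neq0 // pnatr_eq0.
apply: (@cvg_trans _ ((fun h : R => (h^-1 *: (g (h *: v + x) - g x))
   * (f (h *: v + x) + f x)^-1) @ 0^')).
  apply: near_eq_cvg; near=> h.
  have fh : f (h *: v + x) + f x != 0.
    by near: h; exact: (cvgr_neq0 _ fxh).
  rewrite -!fg -!scalerAl; congr (_ *: _); field; exact: fh.
by apply: cvgcM; last exact: cvgcV.
Unshelve. all: by end_near. Qed.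

End derivative_rules.

(** * Stability of smooth functions *)

Section smooth.
Context {R : realType} {V W : normedModType R} {A : set V}.
Hypothesis Aopen : open A.

(** The derivative has to be computed on the set only: the set is open, so
    values outside it do not influence derivatives on it. *)
Lemma is_CkS (k : nat) (f : V -> W) :
  (forall v, exists2 g, forall x, A x -> is_derive x v f (g x) & is_Ck k A g) ->
  is_Ck k.+1 A f.
Proof.
(* On an open set the class C^j depends on the values on the set only. *)
have eqCk : forall j (f g : V -> W), (forall x, A x -> f x = g x) ->
    is_Ck j A f -> is_Ck j A g.
  have near_eq (f' g : V -> W) x : (forall x, A x -> f' x = g x) -> A x ->
      \near x, f' x = g x.
    by move=> fg Ax; apply: filterS (open_nbhs_nbhs (conj Aopen Ax)) => y /fg.
  elim=> [|j IH] /= f' g fg.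
    move=> fC x Ax; rewrite /prop_for /continuous_at -fg //.
    by apply: cvg_trans (fC x Ax); apply: near_eq_cvg; exact: near_eq.
  move=> fC v; have [fd fv] := fC v; split=> [x Ax|].
    by apply: near_eq_derivable (fd x Ax); exact: near_eq.
  by apply: IH fv => x Ax; apply: near_eq_derive; exact: near_eq.
move=> H /= v; have [g fg gC] := H v; split=> [x Ax|].
  by have [] := fg x Ax.
by apply: eqCk gC => x Ax; have [] := fg x Ax.
Qed.

Lemma smooth_on_continuous (f : V -> W) x :
  smooth_on A f -> A x -> {for x, continuous f}.
Proof. by move=> /(_ 0%N); apply. Qed.

Lemma smooth_on_is_derive (f : V -> W) x v :
  smooth_on A f -> A x -> is_derive x v f ('D_v f x).
Proof. by move=> /(_ 1%N) /(_ v)[fd _] Ax; split=> //; exact: fd. Qed.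

Lemma smooth_on_D (f : V -> W) v : smooth_on A f -> smooth_on A ('D_v f).
Proof. by move=> fs k; have [] := fs k.+1 v. Qed.

Lemma is_CkD k (f g : V -> W) : is_Ck k A f -> is_Ck k A g ->
  is_Ck k A (fun x => f x + g x).
Proof.
elim: k f g => [|k IH] f g fC gC.
  by move=> x Ax; apply: cvgD; [exact: fC | exact: gC].
apply: is_CkS => v; have [fd fv] := fC v; have [gd gv] := gC v.
exists (fun x => 'D_v f x + 'D_v g x); last exact: IH.
by move=> x Ax; apply: is_deriveD; split=> //; [exact: fd | exact: gd].
Qed.

Lemma smooth_onD (f g : V -> W) : smooth_on A f -> smooth_on A g ->
  smooth_on A (fun x => f x + g x).
Proof. by move=> fs gs k; exact: is_CkD. Qed.

Lemma smooth_on_cst (c : W) : smooth_on A (fun=> c).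
Proof.
move=> k; elim: k c => [|k IH] c; first by move=> x _; exact: cvg_cst.
by apply: is_CkS => v; exists (fun=> 0) => // x _; exact: is_derive_cst.
Qed.

Lemma smooth_on_linear (L : V -> W) : linear L -> continuous L -> smooth_on A L.
Proof.
move=> Ll Lc [|k]; first by move=> x _; exact: Lc.
apply: is_CkS => v; exists (fun=> L v); last exact: smooth_on_cst.
by move=> x _; exact: is_derive_linear.
Qed.

End smooth.

Lemma smooth_on_linear_comp (R : realType) (V W1 W2 : normedModType R)
    (A : set V) (L : W1 -> W2) (f : V -> W1) : open A ->
  linear L -> continuous L -> smooth_on A f -> smooth_on A (fun x => L (f x)).
Proof.
move=> Ao Ll Lc fs k; elim: k f fs => [|k IH] f fs.
  move=> x Ax; apply: (cvg_comp _ _ (smooth_on_continuous fs Ax)); exact: Lc.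
apply: is_CkS => // v; exists (fun x => L ('D_v f x)).
  move=> x Ax; apply: is_derive_linear_comp => //.
  exact: smooth_on_is_derive.
by apply: IH; exact: smooth_on_D.
Qed.

Lemma smooth_on_subset (R : realType) (V W : normedModType R) (A B : set V)
    (f : V -> W) : A `<=` B -> smooth_on B f -> smooth_on A f.
Proof.
move=> AB fs k; move: (fs k); elim: k f {fs} => [|k IH] f /= fC.
  by move=> x /AB; exact: fC.
by move=> v; have [fd fv] := fC v; split=> [x /AB|]; [exact: fd|exact: IH].
Qed.

Section smooth_complex.
Context {R : realType} {V : normedModType R} {A : set V}.
Hypothesis Aopen : open A.
Local Notation C := (Rcomplex R).
Implicit Types f g : V -> C.

Lemma smooth_onM f g : smooth_on A f -> smooth_on A g ->
  smooth_on A (fun x => f x * g x).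
Proof.
move=> + + k; elim: k f g => [|k IH] f g fs gs.
  by move=> x Ax; apply: cvgcM; exact: smooth_on_continuous Ax.
apply: is_CkS => // v; exists (fun x => 'D_v f x * g x + f x * 'D_v g x).
  by move=> x Ax; apply: is_derivecM; [exact: smooth_on_continuous Ax|
    exact: smooth_on_is_derive Ax ..].
by apply: is_CkD => //; apply: IH => //; exact: smooth_on_D.
Qed.

(** The induction is over all quotients [g / f] of smooth functions at once: the
    quotient rule turns one into another of the same shape, with denominator
    [f * f]. *)
Lemma smooth_onV f : smooth_on A f -> (forall x, A x -> f x != 0) ->
  smooth_on A (fun x => (f x)^-1).
Proof.
move=> + f0 k.
suff: forall g : V -> C, smooth_on A f -> smooth_on A g ->
    is_Ck k A (fun x => g x * (f x)^-1).
  move=> H fs; have := H (fun=> 1) fs (smooth_on_cst Aopen (1 : C)).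
  by under eq_fun do rewrite mul1r.
elim: k f f0 => [|k IH] f f0 g fs gs.
  move=> x Ax; apply: cvgcM; first exact: smooth_on_continuous Ax.
  by apply: cvgcV; [exact: f0 | exact: smooth_on_continuous Ax].
apply: is_CkS => // v.
exists (fun x => ('D_v g x * f x + -1 * (g x * 'D_v f x)) * (f x * f x)^-1).
  move=> x Ax.
  have fc := smooth_on_continuous fs Ax.
  have fx0 := f0 x Ax.
  apply: is_derive_eq.
    apply: is_derivecM; first by apply: cvgcV.
      exact: smooth_on_is_derive Ax.
    by apply: is_derivecV => //; exact: smooth_on_is_derive Ax.
  by rewrite /=; field; rewrite fx0.
apply: IH => [x Ax||]; first by rewrite mulf_neq0 // f0.
  exact: smooth_onM.
apply: smooth_onD => //; first by apply: smooth_onM => //; exact: smooth_on_D.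
apply: smooth_onM; first exact: smooth_on_cst.
by apply: smooth_onM => //; exact: smooth_on_D.
Qed.

(** The products [h * f] with [h] smooth form a family stable under
    differentiation, since [f' = g' / (2 * f) = (g' / (2 * g)) * f]. *)
Lemma smooth_on_sqrt f g : (forall x, f x ^+ 2 = g x) ->
  (forall x, A x -> {for x, continuous f}) -> (forall x, A x -> f x != 0) ->
  smooth_on A g -> smooth_on A f.
Proof.
move=> fg fc f0 gs k.
suff H: forall h : V -> C, smooth_on A h -> is_Ck k A (fun x => h x * f x).
  have := H (fun=> 1 : C) (smooth_on_cst Aopen (1 : C)).
  by under eq_fun do rewrite mul1r.
elim: k => [|k IH] h hs.
  by move=> x Ax; apply: cvgcM; [exact: smooth_on_continuous Ax|exact: fc].
apply: is_CkS => // v.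
exists (fun x => ('D_v h x + 2^-1 * (h x * ('D_v g x * (g x)^-1))) * f x).
  move=> x Ax; have fx0 := f0 x Ax.
  apply: is_derive_eq.
    apply: is_derivecM; [exact: fc | exact: smooth_on_is_derive Ax|].
    apply: (is_derive_sqrt fg); [exact: fc|exact: fx0|].
    exact: smooth_on_is_derive Ax.
  by rewrite /= -fg; field; rewrite fx0.
apply: IH; apply: smooth_onD => //; first exact: smooth_on_D.
apply: smooth_onM; first exact: smooth_on_cst.
apply: smooth_onM => //; apply: smooth_onM; first exact: smooth_on_D.
by apply: smooth_onV => // x Ax; rewrite -fg expf_neq0 // f0.
Qed.

End smooth_complex.

(** * Conjugation and modulus *)

Section conjugation.
Context {R : realType}.
Local Notation C := (Rcomplex R).

Lemma linear_contraction_continuous (V W : normedModType R) (L : V -> W) :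
  linear L -> (forall x, `|L x| <= `|x|) -> continuous L.
Proof.
move=> Ll LN x; apply/subr_cvg0/norm_cvg0P.
have LB y : L (y - x) = L y - L x.
  by rewrite addrC -scaleN1r Ll scaleN1r addrC.
have h0 : `|y - x| @[y --> x] --> (0 : R).
  by apply/norm_cvg0P/subr_cvg0.
apply: (@squeeze_cvgr _ _ _ _ (fun=> 0) _ _ _ _ _ h0); last exact: cvg_cst.
by near=> y; rewrite normr_ge0 /= -LB LN.
Unshelve. all: by end_near. Qed.

Lemma conjC_linear : linear (@conjC R).
Proof. by move=> k [a b] [c d]; congr (_ +i* _)%C => /=; ring. Qed.

Lemma conjCM (x y : C) : conjC (x * y) = conjC x * conjC y.
Proof. exact: (rmorphM (@conjc R)). Qed.

Lemma conjCD (x y : C) : conjC (x + y) = conjC x + conjC y.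
Proof. exact: (rmorphD (@conjc R)). Qed.

Lemma conjCN (x : C) : conjC (- x) = - conjC x.
Proof. exact: (rmorphN (@conjc R)). Qed.

Lemma conjC1 : conjC (1 : C) = 1.
Proof. exact: (rmorph1 (@conjc R)). Qed.

Lemma conjCK (x : C) : conjC (conjC x) = x.
Proof. exact: conjcK. Qed.

Lemma toCD (x y : R) : toC (x + y) = toC x + toC y.
Proof. exact: (rmorphD (real_complex R)). Qed.

Lemma norm_conjC (x : C) : `|conjC x| = `|x|.
Proof. by case: x => a b; rewrite /Num.norm /= sqrrN. Qed.

Lemma norm_toC (x : R) : `|toC x| = `|x|.
Proof. by rewrite -sqrtr_sqr [LHS]/Num.norm /= expr0n addr0. Qed.

Lemma toC_nat (n : nat) : toC (n%:R : R) = n%:R :> C.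
Proof. exact: (rmorph_nat (real_complex R)). Qed.

Lemma toC_sqr_norm (x : C) : toC (`|x| ^+ 2) = x * conjC x.
Proof.
case: x => a b; rewrite /Num.norm /= sqr_sqrtr ?addr_ge0 ?sqr_ge0 //.
by congr (_ +i* _)%C; ring.
Qed.

Lemma continuous_conjC : continuous (@conjC R).
Proof.
apply: linear_contraction_continuous; first exact: conjC_linear.
by move=> x; rewrite norm_conjC.
Qed.

Lemma ler_Re_norm (x : C) : `|complex.Re x| <= `|x|.
Proof.
rewrite -sqrtr_sqr; case: x => a b; rewrite /Num.norm /= ler_wsqrtr //.
by rewrite lerDl sqr_ge0.
Qed.

Lemma imagC_sqr : imagC R * imagC R = -1.
Proof. by congr (_ +i* _)%C; ring. Qed.

Lemma conjC_imagC : conjC (imagC R) = - imagC R.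
Proof. by congr (_ +i* _)%C; ring. Qed.

Lemma smooth_on_conjC (V : normedModType R) (A : set V) (f : V -> C) :
  open A -> smooth_on A f -> smooth_on A (fun x => conjC (f x)).
Proof.
move=> Ao; apply: smooth_on_linear_comp => //; first exact: conjC_linear.
exact: continuous_conjC.
Qed.

Lemma smooth_on_sqr_norm (V : normedModType R) (A : set V) (f : V -> C) :
  open A -> smooth_on A f -> smooth_on A (fun x => `|f x| ^+ 2 : R).
Proof.
move=> Ao fs.
rewrite (_ : (fun _ => _) = fun x => complex.Re (f x * conjC (f x)));
  last first.
  by apply/funext => x; rewrite -toC_sqr_norm.
apply: (@smooth_on_linear_comp R V C R A (@complex.Re R)) => //.
- by move=> k [a b] [c d].
- apply: linear_contraction_continuous; first by move=> k [a b] [c d].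
  exact: ler_Re_norm.
- by apply: smooth_onM => //; exact: smooth_on_conjC.
Qed.

End conjugation.

(** * The principal square root *)

Section principal_square_root.
Context {R : realType}.
Local Notation C := (Rcomplex R).

Lemma Re_sqrtc_ge0 (z : C) : 0 <= complex.Re (sqrtc z).
Proof. by case: z => a b /=; exact: sqrtr_ge0. Qed.

Lemma Re_sqrtc_gt0 (z : C) : 0 < complex.Re z -> 0 < complex.Re (sqrtc z).
Proof.
case: z => a b /= a0; rewrite sqrtr_gt0 divr_gt0 //.
by apply: ltr_wpDl => //; exact: sqrtr_ge0.
Qed.

Lemma sqrtc_neq0 (z : C) : 0 < complex.Re z -> (sqrtc z : C) != 0.
Proof.
by move=> /Re_sqrtc_gt0; apply: contraTneq => ->; rewrite ltxx.
Qed.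

Lemma sqrtcK (z : C) : (sqrtc z : C) ^+ 2 = z.
Proof. exact: sqr_sqrtc. Qed.

(** From [x - z = (sqrt x - sqrt z) * (sqrt x + sqrt z)] and
    [Re (sqrt x) >= 0], the second factor has modulus at least
    [Re (sqrt z) > 0]. *)
Lemma cvg_sqrtc (T : Type) (F : set_system T) (FF : Filter F) (f : T -> C)
    (z : C) :
  0 < complex.Re z -> f @ F --> z ->
  (fun t => sqrtc (f t) : C) @ F --> (sqrtc z : C).
Proof.
move=> z0 fz; have s0 := Re_sqrtc_gt0 z0.
apply/subr_cvg0/norm_cvg0P.
have h0 : (fun t => `|f t - z| * (complex.Re (sqrtc z))^-1) @ F --> (0 : R).
  have -> : (0 : R) = 0 * (complex.Re (sqrtc z))^-1 by rewrite mul0r.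
  apply: cvgM; last exact: cvg_cst.
  by apply/norm_cvg0P/subr_cvg0.
apply: (@squeeze_cvgr _ _ _ _ (fun=> 0) _ _ _ _ _ h0); last exact: cvg_cst.
near=> t; rewrite normr_ge0 /= ler_pdivlMr //.
set x := f t.
have -> : x - z = ((sqrtc x : C) - (sqrtc z : C)) * ((sqrtc x : C) + sqrtc z).
  by rewrite -subr_sqr !sqrtcK.
rewrite normRcomplexM ler_wpM2l //.
apply: le_trans (ler_Re_norm _).
apply: le_trans (ler_norm _).
have -> : complex.Re ((sqrtc x : C) + sqrtc z : C)
    = complex.Re (sqrtc x) + complex.Re (sqrtc z).
  by case: (sqrtc x) (sqrtc z) => [? ?] [? ?].
by rewrite lerDr Re_sqrtc_ge0.
Unshelve. all: by end_near. Qed.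

Lemma continuous_sqrtc_comp (V : normedModType R) (f : V -> C) x :
  0 < complex.Re (f x) -> {for x, continuous f} ->
  {for x, continuous (fun y => sqrtc (f y) : C)}.
Proof. by move=> fx0 fc; exact: cvg_sqrtc. Qed.

Lemma smooth_on_sqrtc (V : normedModType R) (A : set V) (f : V -> C) :
  open A -> smooth_on A f -> (forall x, A x -> 0 < complex.Re (f x)) ->
  smooth_on A (fun x => sqrtc (f x) : C).
Proof.
move=> Ao fs f0; apply: (smooth_on_sqrt Ao _ _ _ fs) => x.
- exact: sqrtcK.
- move=> Ax; apply: continuous_sqrtc_comp; first exact: f0.
  exact: smooth_on_continuous Ax.
- by move=> Ax; exact/sqrtc_neq0/f0.
Qed.

End principal_square_root.

(** * Wirtinger calculus in two variables *)

Section wirtinger_calculus.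
Context {R : realType}.
Local Notation C := (Rcomplex R).
Local Notation C2 := (Complex2 R).
Implicit Types (f g : C2 -> C) (p : C2).

#[local] Arguments conjC : simpl never.

(** The four coefficients are the derivatives in [z], [conj z], [w] and
    [conj w].  Asking for all directions [v] expresses the real differential in
    the basis of the Wirtinger derivatives, in which products and conjugates
    have simple rules. *)
Definition has_wirtinger f p (fz fzb fw fwb : C) := forall v : C2,
  is_derive p v f (fz * v.1 + fzb * conjC v.1 + fw * v.2 + fwb * conjC v.2).

Lemma has_wirtingerE f p fz fzb fw fwb : has_wirtinger f p fz fzb fw fwb ->
  [/\ wirtinger ord0 f p = fz, wirtinger_bar ord0 f p = fzb,
      wirtinger ord_max f p = fw & wirtinger_bar ord_max f p = fwb].
Proof.
move=> fp; have D v := @derive_val _ _ _ _ _ _ _ (fp v).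
have n2 : (2 : C) != 0 by rewrite pnatr_eq0.
have c0 : conjC (0 : C) = 0 by exact: (rmorph0 (@conjc R)).
have halfK (x : C) : 2^-1 * (x + x) = x by field.
have I2 := imagC_sqr (R := R).
rewrite /wirtinger /wirtinger_bar !D /coord_vec /coord_ivec /=.
rewrite !conjC_imagC !conjC1 !c0 !mulr0 !addr0 !add0r !mulr1.
split; rewrite -[RHS]halfK; congr (_ * _); ring: I2.
Qed.

Lemma has_wirtinger_cst (c : C) p : has_wirtinger (fun=> c) p 0 0 0 0.
Proof.
by move=> v; rewrite !mul0r !addr0; exact: is_derive_cst.
Qed.

Lemma has_wirtingerD f g p fz fzb fw fwb gz gzb gw gwb :
  has_wirtinger f p fz fzb fw fwb -> has_wirtinger g p gz gzb gw gwb ->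
  has_wirtinger (fun x => f x + g x) p
    (fz + gz) (fzb + gzb) (fw + gw) (fwb + gwb).
Proof.
move=> fp gp v; apply: is_derive_eq; first apply: is_deriveD.
- exact: fp.
- exact: gp.
by ring.
Qed.

Lemma has_wirtingerM f g p fz fzb fw fwb gz gzb gw gwb :
  {for p, continuous g} ->
  has_wirtinger f p fz fzb fw fwb -> has_wirtinger g p gz gzb gw gwb ->
  has_wirtinger (fun x => f x * g x) p
    (fz * g p + f p * gz) (fzb * g p + f p * gzb)
    (fw * g p + f p * gw) (fwb * g p + f p * gwb).
Proof.
move=> gc fp gp v; apply: is_derive_eq.
  by apply: is_derivecM; [|exact: fp|exact: gp].
by ring.
Qed.

Lemma has_wirtinger_conj f p fz fzb fw fwb :
  has_wirtinger f p fz fzb fw fwb ->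
  has_wirtinger (fun x => conjC (f x)) p
    (conjC fzb) (conjC fz) (conjC fwb) (conjC fw).
Proof.
move=> fp v; apply: is_derive_eq.
  apply: (is_derive_linear_comp conjC_linear); last exact: fp.
  exact: continuous_conjC.
rewrite !conjCD !conjCM !conjCK; ring.
Qed.

Lemma has_wirtingerV f p fz fzb fw fwb : {for p, continuous f} -> f p != 0 ->
  has_wirtinger f p fz fzb fw fwb ->
  has_wirtinger (fun x => (f x)^-1) p
    (- fz * (f p)^-1 ^+ 2) (- fzb * (f p)^-1 ^+ 2)
    (- fw * (f p)^-1 ^+ 2) (- fwb * (f p)^-1 ^+ 2).
Proof.
move=> fc fp0 fp v; apply: is_derive_eq.
  by apply: is_derivecV => //; exact: fp.
by ring.
Qed.

Lemma has_wirtinger_sqrtc f p fz fzb fw fwb :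
  {for p, continuous f} -> 0 < complex.Re (f p) ->
  has_wirtinger f p fz fzb fw fwb ->
  has_wirtinger (fun x => sqrtc (f x) : C) p
    (fz * (2 * (sqrtc (f p) : C))^-1) (fzb * (2 * (sqrtc (f p) : C))^-1)
    (fw * (2 * (sqrtc (f p) : C))^-1) (fwb * (2 * (sqrtc (f p) : C))^-1).
Proof.
move=> fc fp0 fp v; apply: is_derive_eq.
  apply: (is_derive_sqrt (g := f)); last exact: fp.
  - by move=> y; exact: sqrtcK.
  - exact: continuous_sqrtc_comp.
  - exact: sqrtc_neq0.
by ring.
Qed.

Lemma linear_fst : linear (fst : C2 -> C). Proof. by []. Qed.
Lemma linear_snd : linear (snd : C2 -> C). Proof. by []. Qed.

Lemma continuous_fst : continuous (fst : C2 -> C).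
Proof.
apply: linear_contraction_continuous => // x.
by rewrite prod_normE le_max lexx.
Qed.

Lemma continuous_snd : continuous (snd : C2 -> C).
Proof.
apply: linear_contraction_continuous => // x.
by rewrite prod_normE le_max lexx orbT.
Qed.

Lemma has_wirtinger_fst p : has_wirtinger fst p 1 0 0 0.
Proof.
move=> v; apply: is_derive_eq; first apply: is_derive_linear.
- exact: linear_fst.
- exact: continuous_fst.
- by ring.
Qed.

Lemma has_wirtinger_snd p : has_wirtinger snd p 0 0 1 0.
Proof.
move=> v; apply: is_derive_eq; first apply: is_derive_linear.
- exact: linear_snd.
- exact: continuous_snd.
- by ring.
Qed.

End wirtinger_calculus.

(** * Holomorphic functions and the complex Hessian *)

Section holomorphic.
Context {R : realType}.
Local Notation C := (Rcomplex R).
Local Notation C2 := (Complex2 R).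
Implicit Types (f g h : C2 -> C) (p : C2) (A : set C2).

(** The Cauchy-Riemann equations are the vanishing of both [conj]-coefficients;
    the partial derivatives [f1] in [z] and [f2] in [w] are carried along
    because the complex Hessian is computed from them.  Continuity is needed
    for the product rule and does not follow from directional derivatives alone. *)
Definition holomorphic_on A f f1 f2 := forall p, A p ->
  {for p, continuous f} /\ has_wirtinger f p (f1 p) 0 (f2 p) 0.

Lemma holomorphic_on_eq A f f1 f2 f1' f2' :
  (forall p, A p -> f1 p = f1' p) -> (forall p, A p -> f2 p = f2' p) ->
  holomorphic_on A f f1 f2 -> holomorphic_on A f f1' f2'.
Proof. by move=> e1 e2 fh p Ap; rewrite -e1 // -e2 //; exact: fh. Qed.

Lemma holomorphic_on_cst A (c : C) :
  holomorphic_on A (fun=> c) (fun=> 0) (fun=> 0).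
Proof. by move=> p _; split; [exact: cvg_cst | exact: has_wirtinger_cst]. Qed.

Lemma holomorphic_on_fst A : holomorphic_on A fst (fun=> 1) (fun=> 0).
Proof.
by move=> p _; split; [exact: continuous_fst | exact: has_wirtinger_fst].
Qed.

Lemma holomorphic_on_snd A : holomorphic_on A snd (fun=> 0) (fun=> 1).
Proof.
by move=> p _; split; [exact: continuous_snd | exact: has_wirtinger_snd].
Qed.

Lemma holomorphic_onD A f f1 f2 g g1 g2 :
  holomorphic_on A f f1 f2 -> holomorphic_on A g g1 g2 ->
  holomorphic_on A (fun p => f p + g p)
    (fun p => f1 p + g1 p) (fun p => f2 p + g2 p).
Proof.
move=> fh gh p Ap; have [fc fp] := fh p Ap; have [gc gp] := gh p Ap.
split; first exact: cvgD.
by have := has_wirtingerD fp gp; rewrite !addr0.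
Qed.

Lemma holomorphic_onM A f f1 f2 g g1 g2 :
  holomorphic_on A f f1 f2 -> holomorphic_on A g g1 g2 ->
  holomorphic_on A (fun p => f p * g p)
    (fun p => f1 p * g p + f p * g1 p) (fun p => f2 p * g p + f p * g2 p).
Proof.
move=> fh gh p Ap; have [fc fp] := fh p Ap; have [gc gp] := gh p Ap.
split; first exact: cvgcM.
by have := has_wirtingerM gc fp gp; rewrite !mul0r !mulr0 !addr0.
Qed.

Lemma holomorphic_onV A f f1 f2 : (forall p, A p -> f p != 0) ->
  holomorphic_on A f f1 f2 ->
  holomorphic_on A (fun p => (f p)^-1)
    (fun p => - f1 p * (f p)^-1 ^+ 2) (fun p => - f2 p * (f p)^-1 ^+ 2).
Proof.
move=> f0 fh p Ap; have [fc fp] := fh p Ap.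
split; first by apply: cvgcV => //; exact: f0.
by have := has_wirtingerV fc (f0 _ Ap) fp; rewrite !oppr0 !mul0r.
Qed.

Lemma holomorphic_on_sqrtc A f f1 f2 :
  (forall p, A p -> 0 < complex.Re (f p)) ->
  holomorphic_on A f f1 f2 ->
  holomorphic_on A (fun p => sqrtc (f p) : C)
    (fun p => f1 p * (2 * (sqrtc (f p) : C))^-1)
    (fun p => f2 p * (2 * (sqrtc (f p) : C))^-1).
Proof.
move=> f0 fh p Ap; have [fc fp] := fh p Ap.
split; first by apply: continuous_sqrtc_comp => //; exact: f0.
by have := has_wirtinger_sqrtc fc (f0 _ Ap) fp; rewrite !mul0r.
Qed.

Lemma has_wirtinger_mul_conj A f f1 f2 h h1 h2 p : A p ->
  holomorphic_on A f f1 f2 -> holomorphic_on A h h1 h2 ->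
  has_wirtinger (fun q => f q * conjC (h q)) p
    (f1 p * conjC (h p)) (f p * conjC (h1 p))
    (f2 p * conjC (h p)) (f p * conjC (h2 p)).
Proof.
move=> Ap fh hh; have [fc fp] := fh p Ap; have [hc hp] := hh p Ap.
have hcc : {for p, continuous (fun q => conjC (h q))}.
  by apply: (cvg_comp _ _ hc); exact: continuous_conjC.
have := has_wirtingerM hcc fp (has_wirtinger_conj hp).
have -> : conjC (0 : C) = 0 by exact: (rmorph0 (@conjc R)).
by rewrite !mul0r !mulr0 !addr0 !add0r.
Qed.

Lemma near_eq_wirtinger i f g p : (\near p, f p = g p) ->
  wirtinger i f p = wirtinger i g p.
Proof.
by move=> fg; rewrite /wirtinger !(near_eq_derive _ fg).
Qed.

(** Holomorphy of [f1], [f2], [g1] and [g2] makes the derivatives in [z] and [w]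
    of their conjugates vanish, so that the entry [(i, j)] of the Hessian is
    [f_i * conj f_j + g_i * conj g_j]: the Hessian is the product of the
    transposed Jacobian matrix and its adjoint. *)
Lemma det_complex_hessian_sqr_norm A f f1 f2 f11 f12 f21 f22
    g g1 g2 g11 g12 g21 g22 (k : R) p : open A -> A p ->
  holomorphic_on A f f1 f2 ->
  holomorphic_on A f1 f11 f12 -> holomorphic_on A f2 f21 f22 ->
  holomorphic_on A g g1 g2 ->
  holomorphic_on A g1 g11 g12 -> holomorphic_on A g2 g21 g22 ->
  \det (complex_hessian (fun q => `|f q| ^+ 2 + `|g q| ^+ 2 + k) p)
  = (f1 p * g2 p - f2 p * g1 p) * conjC (f1 p * g2 p - f2 p * g1 p).
Proof.
move=> Ao Ap fh f1h f2h gh g1h g2h.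
set u := fun q => toC (`|f q| ^+ 2 + `|g q| ^+ 2 + k).
have uE : u = fun q => f q * conjC (f q) + g q * conjC (g q) + toC k.
  by apply/funext => q; rewrite /u !toCD !toC_sqr_norm.
have u_bar q : A q ->
    wirtinger_bar ord0 u q = f q * conjC (f1 q) + g q * conjC (g1 q) /\
    wirtinger_bar ord_max u q = f q * conjC (f2 q) + g q * conjC (g2 q).
  move=> Aq; rewrite uE.
  have := has_wirtingerD (has_wirtingerD (has_wirtinger_mul_conj Aq fh fh)
    (has_wirtinger_mul_conj Aq gh gh)) (has_wirtinger_cst (toC k) q).
  by rewrite !addr0 => /has_wirtingerE[].
have nearA F G : (forall q, A q -> F q = G q) -> \near p, F p = G p :> C.
  by move=> FG; apply: filterS (open_nbhs_nbhs (conj Ao Ap)) => q /FG.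
have u0 i := near_eq_wirtinger i (nearA _ _ (fun q Aq => (u_bar q Aq).1)).
have u1 i := near_eq_wirtinger i (nearA _ _ (fun q Aq => (u_bar q Aq).2)).
have [Eu00 _ Eu10 _] := has_wirtingerE (has_wirtingerD
  (has_wirtinger_mul_conj Ap fh f1h) (has_wirtinger_mul_conj Ap gh g1h)).
have [Eu01 _ Eu11 _] := has_wirtingerE (has_wirtingerD
  (has_wirtinger_mul_conj Ap fh f2h) (has_wirtinger_mul_conj Ap gh g2h)).
have E1 : lift ord0 ord0 = ord_max :> 'I_2 by exact: val_inj.
have E2 : lift ord_max ord0 = ord0 :> 'I_2 by exact: val_inj.
rewrite (expand_det_row _ ord0) !big_ord_recl big_ord0 /cofactor !det_mx11.
rewrite !mxE /= !E1 E2 -/u !u0 !u1 Eu00 Eu01 Eu10 Eu11.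
rewrite conjCD conjCN !conjCM /= /bump /=; ring.
Qed.

End holomorphic.

(** * The family of solutions *)

Section solutions.
Context {R : realType}.
Local Notation C := (Rcomplex R).
Local Notation C2 := (Complex2 R).
Variable alpha : C.
Hypothesis alpha0 : alpha != 0.

(** The squared length of the unimodular map [Phi (z, w) = (phi z, w * s z)], up
    to the constant [k]. *)
Definition solution (k : R) (p : C2) : R :=
  `|phi alpha p.1| ^+ 2 + `|p.2 * sqrtc (1 - 2 * alpha * p.1) : C| ^+ 2 + k.

Let radicand (p : C2) : C := 1 - 2 * alpha * p.1.
Let root (p : C2) : C := sqrtc (radicand p).

(** On the disc, [|2 * alpha * z| < 1]. *)
Lemma Re_radicand_gt0 (z : C) : `|z| < 1 / (2 * `|alpha|) ->
  0 < complex.Re (1 - 2 * alpha * z : C).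
Proof.
have na0 : 0 < `|alpha| by rewrite normr_gt0.
rewrite ltr_pdivlMr ?mulr_gt0 // => zlt.
have -> : complex.Re (1 - 2 * alpha * z : C)
    = 1 - complex.Re (2 * alpha * z : C).
  by case: (2 * alpha * z : C).
rewrite subr_gt0; apply: le_lt_trans zlt; apply: le_trans (ler_norm _) _.
apply: le_trans (ler_Re_norm _) _.
rewrite !normRcomplexM [X in _ <= X]mulrC ler_wpM2r // ler_wpM2r //.
by rewrite -toC_nat norm_toC normr_nat.
Qed.

(** Expand [|w * s| ^ 2] with [s = 1 - alpha * phi]. *)
Lemma solution_ansatz (k : R) (p : C2) :
  toC (solution k p) =
  ansatz alpha (fun w => 1 + `|alpha * w : C| ^+ 2) (fun=> 0)
    (fun w => - alpha * (w * conjC w)) (fun w => `|w| ^+ 2 + k) p.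
Proof.
case: p => z w; rewrite /solution /ansatz /=.
have -> : (sqrtc (1 - 2 * alpha * z) : C) = 1 - alpha * phi alpha z.
  by rewrite /phi; field.
rewrite !toCD !toC_sqr_norm !conjCM !conjCD !conjCN !conjCM conjCK.
have -> : conjC (1 : C) = 1 := conjC1.
have -> : conjC (0 : C) = 0 by exact: (rmorph0 (@conjc R)).
have -> : toC 1 = 1 :> C by [].
ring.
Qed.

Variable Omega : set C2.
Hypothesis openO : open Omega.
Hypothesis subO : Omega `<=` disc (1 / (2 * `|alpha|)) `*` [set: C].

Lemma radicand_gt0 p : Omega p -> 0 < complex.Re (radicand p).
Proof. by move=> /subO[/Re_radicand_gt0]. Qed.

Lemma root_neq0 p : Omega p -> root p != 0.
Proof. by move=> /radicand_gt0 /sqrtc_neq0. Qed.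

Lemma radicandE : radicand = fun p => 1 + - (2 * alpha) * p.1.
Proof. by apply/funext => p; rewrite /radicand; ring. Qed.

Lemma holomorphic_root :
  holomorphic_on Omega root (fun p => - alpha * (root p)^-1) (fun=> 0).
Proof.
have := holomorphic_onD (@holomorphic_on_cst R Omega 1)
    (holomorphic_onM (@holomorphic_on_cst R Omega (- (2 * alpha)))
       (@holomorphic_on_fst R Omega)).
rewrite -radicandE => /(holomorphic_on_sqrtc radicand_gt0).
apply: holomorphic_on_eq => p Op; last by ring.
by have := root_neq0 Op; rewrite -/(root p) => ?; field.
Qed.

Lemma holomorphic_inv_root :
  holomorphic_on Omega (fun p => (root p)^-1)
    (fun p => alpha * (root p)^-1 ^+ 3) (fun=> 0).
Proof.
apply: holomorphic_on_eq (holomorphic_onV root_neq0 holomorphic_root) => p Op;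
  by ring.
Qed.

(** The identity [phi' = 1 / s] that makes the Jacobian determinant equal to
    1. *)
Lemma holomorphic_phi :
  holomorphic_on Omega (fun p => phi alpha p.1)
    (fun p => (root p)^-1) (fun=> 0).
Proof.
have := holomorphic_onM
  (holomorphic_onD (@holomorphic_on_cst R Omega 1)
    (holomorphic_onM (@holomorphic_on_cst R Omega (- 1)) holomorphic_root))
  (@holomorphic_on_cst R Omega alpha^-1).
rewrite (_ : (fun p => (1 + -1 * root p) / alpha) = (fun p => phi alpha p.1)).
  apply: holomorphic_on_eq => p Op; last by ring.
  by have r0 := root_neq0 Op; field; rewrite alpha0 r0.
by apply/funext => p; rewrite /phi mulN1r.
Qed.

Lemma det_complex_hessian_solution (k : R) p : Omega p ->
  \det (complex_hessian (solution k) p) = 1.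
Proof.
move=> Op.
have h0 := @holomorphic_on_cst R Omega 0.
have hz : holomorphic_on Omega (fun p => p.2 * root p)
    (fun p => - alpha * (p.2 * (root p)^-1)) root.
  apply: holomorphic_on_eq (holomorphic_onM (@holomorphic_on_snd R Omega)
    holomorphic_root) => q Oq; by ring.
have hz1 := holomorphic_onM (@holomorphic_on_cst R Omega (- alpha))
  (holomorphic_onM (@holomorphic_on_snd R Omega) holomorphic_inv_root).
rewrite (det_complex_hessian_sqr_norm k openO Op holomorphic_phi
  holomorphic_inv_root h0 hz hz1 holomorphic_root).
have -> : (root p)^-1 * root p - 0 * (- alpha * (p.2 * (root p)^-1)) = 1.
  by have := root_neq0 Op => ?; field.
by rewrite conjC1 mulr1.
Qed.

Lemma smooth_on_fst (A : set C2) : open A -> smooth_on A (fst : C2 -> C).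
Proof.
by move=> Ao; apply: smooth_on_linear => //; exact: continuous_fst.
Qed.

Lemma smooth_on_snd (A : set C2) : open A -> smooth_on A (snd : C2 -> C).
Proof.
by move=> Ao; apply: smooth_on_linear => //; exact: continuous_snd.
Qed.

Lemma smooth_on_solution (k : R) : smooth_on Omega (solution k).
Proof.
have cst (c : C) := smooth_on_cst openO c.
have sr : smooth_on Omega root.
  apply: smooth_on_sqrtc => //; last exact: radicand_gt0.
  rewrite radicandE; apply: smooth_onD => //.
  by apply: smooth_onM => //; exact: smooth_on_fst.
apply: smooth_onD => //; last exact: (smooth_on_cst openO k).
apply: smooth_onD => //; apply: smooth_on_sqr_norm => //.
  rewrite (_ : (fun p => _) = fun p => (1 + -1 * root p) / alpha); last first.
    by apply/funext => p; rewrite /phi mulN1r.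
  apply: smooth_onM => //; apply: smooth_onD => //; exact: smooth_onM.
by apply: smooth_onM => //; exact: smooth_on_snd.
Qed.

Lemma has_ansatz_solution (k : R) : has_ansatz Omega alpha (solution k).
Proof.
have oT : open [set: C] by exact: openT.
have cst (W : normedModType R) (c : W) := @smooth_on_cst R C W setT oT c.
have sid : smooth_on setT (fun w : C => w).
  by apply: (smooth_on_linear oT) => // x; exact: cvg_id.
exists (fun w => 1 + `|alpha * w : C| ^+ 2), (fun=> 0),
  (fun w => - alpha * (w * conjC w)), (fun w => `|w| ^+ 2 + k).
split; first split.
- apply: (smooth_on_subset (@subsetT _ _)).
  apply: (smooth_onD oT); [exact: (cst R)|].
  apply: (smooth_on_sqr_norm oT).
  by apply: (smooth_onM oT); [exact: (cst C)|].
- exact: (smooth_on_subset (@subsetT _ _) (cst C 0)).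
- apply: (smooth_on_subset (@subsetT _ _)).
  apply: (smooth_onM oT); [exact: (cst C)|].
  apply: (smooth_onM oT) => //.
  by apply: (smooth_on_conjC oT).
- apply: (smooth_on_subset (@subsetT _ _)).
  apply: (smooth_onD oT); [ |exact: (cst R)].
  by apply: (smooth_on_sqr_norm oT).
- split=> [w _|p _]; first by rewrite ltr_pwDl // exprn_ge0.
  exact: solution_ansatz.
Qed.

End solutions.

(** If [|p| < M] on the set, then [alpha = 1 / (2 M)] makes the radius of the
    disc equal to [M]. *)
Lemma bounded_sub_cylinder (R : realType) (Omega : set (Complex2 R)) :
  bounded_set Omega -> exists2 alpha : Rcomplex R, alpha != 0 &
    Omega `<=` disc (1 / (2 * `|alpha|)) `*` [set: Rcomplex R].
Proof.
move=> /ex_strict_bound_gt0[M M0 OM].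
have aM : `|toC (2 * M)^-1| = (2 * M)^-1.
  by rewrite norm_toC ger0_norm // invr_ge0 mulr_ge0 // ltW.
exists (toC (2 * M)^-1).
  by rewrite -normr_eq0 aM invr_neq0 // mulf_neq0 // gt_eqF.
move=> p /OM /= pM; split=> //; rewrite /disc /= aM.
have -> : 1 / (2 * (2 * M)^-1) = M by field; rewrite gt_eqF.
by apply: le_lt_trans pM; rewrite prod_normE le_max lexx.
Qed.

Unset Implicit Arguments.

(* Solutions are counted as functions on [Omega]: [u \_ Omega] forgets the
   values of [u] outside [Omega]. *)
Theorem theorem6p2 (R : realType) (Omega : set (Complex2 R))
    (hOmega : bounded_domain Omega) :
  exists alpha : Rcomplex R,
    [/\ alpha != 0,
        Omega `<=` disc (1 / (2 * `|alpha|)) `*` [set: Rcomplex R] &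
        infinite_set [set u \_ Omega | u in
          [set u : Complex2 R -> R |
            [/\ smooth_on Omega u,
                (forall p, Omega p -> \det (complex_hessian u p) = 1) &
                has_ansatz Omega alpha u]]]].
Proof.
have [[p0 Op0] openO _ /bounded_sub_cylinder[alpha alpha0 subO]] := hOmega.
exists alpha; split=> // Sfin; apply: infinite_nat.
pose u (n : nat) := solution alpha n%:R \_ Omega.
have -> : [set: nat] = u @^-1` [set u \_ Omega | u in
    [set u : Complex2 R -> R | [/\ smooth_on Omega u,
      (forall p, Omega p -> \det (complex_hessian u p) = 1) &
      has_ansatz Omega alpha u]]].
  apply/esym/seteqP; split=> // n _; exists (solution alpha n%:R) => //; split.
  - exact: smooth_on_solution.
  - by move=> p; exact: det_complex_hessian_solution.
  - exact: has_ansatz_solution.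
apply: finite_preimage Sfin => m n _ _ /(congr1 (@^~ p0)).
by rewrite /u !patchT ?inE // => /addrI/(mulrIn (oner_neq0 R)).
Qed.
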